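(* For any formula $\phi$ of $\mathcal L$ and any enumeration $\{\xi_u\}_{u\in U}$ of deterministic partial recursive functions, the following are equivalent: (1) $\{\xi_u\}_{u\in U}\vDash\phi$; (2) $w\Vdash\phi$ for every world $w$ of every deterministic Kripke model; (3) $\vdash_{\Re_d}\phi$.
   Context: The language $\mathcal L$: formulas built from propositional variables and $\bot$ using $\rightarrow$ and a binary modality $\rhd$; $\wedge,\vee,\neg,\top$ defined as usual. The logic $\Re$: classical propositional logic in $\mathcal L$ plus axioms A1: $\phi\rhd\psi\rightarrow(\chi\rhd\psi\rightarrow(\phi\vee\chi)\rhd\psi)$, A2: $\bot\rhd\phi$, A3: $\phi\rhd\top$, with rules Modus Ponens and M: from $\phi_1\rightarrow\phi_2$ and $\psi_1\rightarrow\psi_2$ infer $\phi_2\rhd\psi_1\rightarrow\phi_1\rhd\psi_2$. The logic $\Re_d$ is $\Re$ plus axiom A4: $\phi\rhd\psi\rightarrow(\phi\rhd\chi\rightarrow\phi\rhd(\psi\wedge\chi))$. Kripke model: a triple $\langle W,\rightarrow,\Vdash\rangle$ with $W$ a finite set of worlds, $\rightarrow$ a ternary relation written $u\rightarrow_w v$, $\Vdash$ a relation between worlds and propositional variables, extended by: $w\nVdash\bot$; $w\Vdash\phi\rightarrow\psi$ iff $w\nVdash\phi$ or $w\Vdash\psi$; $w\Vdash\phi\rhd\psi$ iff for all $u,v$ with $u\rightarrow_w v$ and $u\Vdash\phi$ there is $v'$ with $u\rightarrow_w v'$ and $v'\Vdash\psi$. It is deterministic if for all $w,u\in W$ there is at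 most one $v$ with $u\rightarrow_w v$. Semantics: $U$ is a universe (e.g. all words over an alphabet) and $\{\xi_u\}_{u\in U}$ is an enumeration, indexed by elements of $U$, of all deterministic partial recursive functions from $U$ to $U$, viewed set-valued: $\xi_w(x)$ is $\varnothing$ if $\xi_w$ diverges on $x$ and the singleton of its value otherwise. The enumeration is assumed to satisfy the following form of Kleene's recursion theorem: for any total recursive $f_1,\dots,f_n:U^n\to U$ there are $u_1,\dots,u_n\in U$ with $\xi_{u_i}\equiv\xi_{f_i(u_1,\dots,u_n)}$ for all $i$. A valuation $*$ maps propositional variables to subsets of $U$, extended by $\bot^*=\varnothing$, $(\phi\rightarrow\psi)^*=(U\setminus\phi^* )\cup\psi^*$, $(\phi\rhd\psi)^*=\{w\in U\mid\forall u\in\phi^*\ (\xi_w(u)\neq\varnothing\rightarrow\xi_w(u)\cap\psi^*\neq\varnothing)\}$. $\{\xi_u\}_{u\in U}\vDash\phi$ means $\phi^*=U$ for every valuation $*$. *)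

(* Defs.v *)
From mathcomp Require Import ssreflect ssrfun ssrbool eqtype ssrnat seq choice.
From mathcomp Require Import fintype tuple.
From mathcomp Require Import classical_sets.

Set Implicit Arguments.
Unset Strict Implicit.
Unset Printing Implicit Defensive.

Local Open Scope classical_set_scope.

Inductive formula : Type :=
| Var of nat
| Bot
| Imp of formula & formula
| Tri of formula & formula.

Declare Scope formula_scope.
Delimit Scope formula_scope with F.
Bind Scope formula_scope with formula.

Definition Neg (a : formula) := Imp a Bot.
Definition Top := Neg Bot.
Definition Or (a b : formula) := Imp (Neg a) b.
Definition And (a b : formula) := Neg (Imp a (Neg b)).

Notation "a ~> b" := (Imp a b) (at level 60, right associativity) : formula_scope.
Notation "a |> b" := (Tri a b) (at level 55, no associativity) : formula_scope.

Inductive Re_axiom : formula -> Prop :=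
| A1 a b c : Re_axiom (a |> b ~> (c |> b ~> Or a c |> b))
| A2 a : Re_axiom (Bot |> a)
| A3 a : Re_axiom (a |> Top).

Inductive Red_axiom : formula -> Prop :=
| Red_Re a : Re_axiom a -> Red_axiom a
| A4 a b c : Red_axiom (a |> b ~> (a |> c ~> a |> And b c)).

(* CPL_K, CPL_S and CPL_DN with modus ponens form a complete axiomatisation
   of classical propositional logic over the connectives ~> and Bot. *)
Inductive derivable (Ax : formula -> Prop) : formula -> Prop :=
| CPL_K a b : derivable Ax (a ~> (b ~> a))
| CPL_S a b c : derivable Ax ((a ~> (b ~> c)) ~> ((a ~> b) ~> (a ~> c)))
| CPL_DN a : derivable Ax (Neg (Neg a) ~> a)
| Axm a : Ax a -> derivable Ax a
| MP a b : derivable Ax (a ~> b) -> derivable Ax a -> derivable Ax b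
| RuleM a1 a2 b1 b2 :
    derivable Ax (a1 ~> a2) -> derivable Ax (b1 ~> b2) ->
    derivable Ax (a2 |> b1 ~> a1 |> b2).

Definition Re : formula -> Prop := derivable Re_axiom.
Definition Red : formula -> Prop := derivable Red_axiom.

(* [step w u v] is the ternary relation u ->_w v. *)
Record kripke : Type := Kripke {
  world :> finType;
  step : world -> world -> world -> Prop;
  val : world -> nat -> Prop
}.

Fixpoint forces (M : kripke) (w : M) (a : formula) : Prop :=
  match a with
  | Var p => val w p
  | Bot => False
  | Imp b c => ~ forces w b \/ forces w c
  | Tri b c => forall u v : M, step w u v -> forces u b ->
                 exists v' : M, step w u v' /\ forces v' c
  end.

Definition deterministic (M : kripke) : Prop :=
  forall w u v v' : M, step w u v -> step w u v' -> v = v'.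

(* Programs for the n-ary partial recursive functions on nat. *)
Inductive murec : nat -> Type :=
| MZero : murec 0
| MSucc : murec 1
| MProj n of 'I_n : murec n
| MComp m n of murec m & ('I_m -> murec n) : murec n
| MRec n of murec n & murec n.+2 : murec n.+1
| MMin n of murec n.+1 : murec n.

Fixpoint iter_rec (F : set nat) (G : nat -> nat -> set nat) (k : nat) : set nat :=
  if k is k'.+1 then \bigcup_(z in iter_rec F G k') G k' z else F.

(* The value of a partial function is the empty set where it diverges and a
   singleton where it converges, see [sem_subset1]. *)
Fixpoint sem n (p : murec n) : n.-tuple nat -> set nat :=
  match p in murec n return n.-tuple nat -> set nat with
  | MZero => fun _ => [set 0]
  | MSucc => fun xs => [set (thead xs).+1]
  | MProj _ i => fun xs => [set tnth xs i]
  | MComp m _ f gs => fun xs => [set y | exists ys : m.-tuple nat,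
      (forall i, sem (gs i) xs (tnth ys i)) /\ sem f ys y]
  | MRec _ f g => fun xs =>
      iter_rec (sem f [tuple of behead xs])
               (fun k z => sem g [tuple of k :: z :: behead xs]) (thead xs)
  | MMin _ f => fun xs => [set y | sem f [tuple of y :: xs] 0 /\
      forall k, k < y -> exists z, sem f [tuple of k :: xs] z.+1]
  end.

Lemma sem_subset1 n (p : murec n) (xs : n.-tuple nat) : is_subset1 (sem p xs).
Proof.
elim: p xs => {n} /=.
- by move=> _ x y -> ->.
- by move=> xs x y -> ->.
- by move=> n i xs x y -> ->.
- move=> m n f IHf gs IHg xs x y [us [Hu Hx]] [vs [Hv Hy]].
  have E : us = vs by apply: eq_from_tnth => i; apply: IHg (Hu i) (Hv i).
  by rewrite -E in Hy; apply: IHf Hx Hy.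
- move=> n f IHf g IHg xs; elim: (thead xs) => [|k IHk] /=; first exact: IHf.
  move=> x y [z Hz Hx] [z' Hz' Hy].
  by rewrite -(IHk _ _ Hz Hz') in Hy; apply: IHg Hx Hy.
- move=> n f IHf xs x y [Hx Lx] [Hy Ly].
  have [lxy|lyx|//] := ltngtP x y.
  + by have [z Hz] := Ly _ lxy; have := IHf _ _ _ Hx Hz.
  + by have [z Hz] := Lx _ lyx; have := IHf _ _ _ Hy Hz.
Qed.

(* Recursiveness over a universe U is relative to a bijective coding of U by
   natural numbers (for words over a finite alphabet, e.g. the position in the
   length-lexicographic order). *)
Definition partial_recursive (U : Type) (code : U -> nat) n
    (F : n.-tuple U -> set U) : Prop :=
  exists p : murec n, forall xs : n.-tuple U,
    F xs = [set y | sem p (map_tuple code xs) (code y)].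

Definition partial_recursive1 (U : Type) (code : U -> nat) (F : U -> set U) :=
  partial_recursive code (fun xs : 1.-tuple U => F (thead xs)).

Definition total_recursive (U : Type) (code : U -> nat) n
    (f : n.-tuple U -> U) : Prop :=
  partial_recursive code (fun xs => [set f xs]).

Definition enumeration (U : Type) (code : U -> nat) (xi : U -> U -> set U) : Prop :=
  (forall u, partial_recursive1 code (xi u)) /\
  (forall F : U -> set U, partial_recursive1 code F -> exists u, xi u =1 F).

Definition recursion_theorem (U : Type) (code : U -> nat) (xi : U -> U -> set U) : Prop :=
  forall n (f : 'I_n -> n.-tuple U -> U),
    (forall i, total_recursive code (f i)) ->
    exists u : n.-tuple U, forall i, xi (tnth u i) =1 xi (f i u).

Fixpoint interp (U : Type) (xi : U -> U -> set U) (V : nat -> set U)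
    (a : formula) : set U :=
  match a with
  | Var p => V p
  | Bot => set0
  | Imp b c => ~` interp xi V b `|` interp xi V c
  | Tri b c => [set w | forall u, interp xi V b u ->
                  xi w u !=set0 -> xi w u `&` interp xi V c !=set0]
  end.

Definition valid (U : Type) (xi : U -> U -> set U) (a : formula) : Prop :=
  forall V : nat -> set U, interp xi V a = setT.

(* Main.v *)
Require Import Defs.
From HB Require Import structures.
From mathcomp Require Import ssreflect ssrfun ssrbool eqtype ssrnat seq choice.
From mathcomp Require Import fintype finfun tuple.
From mathcomp Require Import boolp classical_sets.

(* Completeness for deterministic Kripke models uses maximal consistent sets,
   identified when they agree on the subformulas of [phi].  The key fact is that
   a refuted [b |> c] in T is witnessed by a pair of sets (T1, T2), with [b] in
   T1 and [c] not in T2, that respects every [b' |> c'] in T.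

   A deterministic countermodel is transferred to programs by unravelling it to
   the modal depth of the formula: at each level a world becomes a program whose
   graph is a finite table between programs of the previous level.  This needs
   no self-reference; the recursion theorem serves only to show that every
   partial recursive function has infinitely many indices, so that distinct
   worlds, possibly with the same table, get distinct programs. *)

Set Implicit Arguments.
Unset Strict Implicit.
Unset Printing Implicit Defensive.

Local Open Scope classical_set_scope.

HB.instance Definition _ := gen_eqMixin formula.
HB.instance Definition _ := gen_choiceMixin formula.

(** * Soundness for both semantics *)

(** A common form of the two semantics, with [xi w u v] read as a step, so that soundness is proved
    once. *)
Definition satisfaction (W : Type) (R : W -> W -> W -> Prop)
    (sat : W -> formula -> Prop) : Prop :=
  [/\ forall w, ~ sat w Bot,
      forall w a b, sat w (a ~> b)%F <-> (sat w a -> sat w b) &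
      forall w a b, sat w (a |> b)%F <->
        (forall u v, R w u v -> sat u a -> exists v', R w u v' /\ sat v' b)].

Lemma forces_satisfaction (M : kripke) : satisfaction (@step M) (@forces M).
Proof.
split=> [w []|w a b|w a b] //=; split=> [[na /na|]//|h].
by have [/h|] := pselect (forces w a); [right|left].
Qed.

Lemma interp_satisfaction (U : Type) (xi : U -> U -> set U) (V : nat -> set U) :
  satisfaction xi (fun w a => interp xi V a w).
Proof.
split=> [w []|w a b|w a b] /=.
- split=> [[na /na|]//|h].
  by have [/h|] := pselect (interp xi V a w); [right|left].
- split=> [h u v uv au|h u au [v uv]].
  + by have [v' []] := h u au (ex_intro _ v uv); exists v'.
  + by have [v' []] := h u v uv au; exists v'.
Qed.

Lemma soundness (W : Type) (R : W -> W -> W -> Prop)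
    (sat : W -> formula -> Prop) (a : formula) :
  satisfaction R sat -> (forall w u v v', R w u v -> R w u v' -> v = v') ->
  Red a -> forall w, sat w a.
Proof.
move=> [satB satI satT] det.
elim=> {a} [a b|a b c|a|a axa|a b _ IHab _ IHa|a1 a2 b1 b2 _ IHa _ IHb] w.
- by rewrite !satI.
- rewrite !satI => h1 h2 h; exact: h1 h (h2 h).
- by rewrite !satI => h; apply: contrapT => na; apply: (satB w (h _)) => /na.
- case: axa => [{}a [b c d|b|b]|b c d].
  + rewrite !satI !satT => h1 h2 u v uv; rewrite !satI => h.
    have [bu|nbu] := pselect (sat u b); first exact: h1 uv bu.
    by apply: h2 uv (h _) => /nbu.
  + by rewrite satT => u v _ /satB.
  + by rewrite satT => u v uv _; exists v; split=> //; rewrite satI => /satB.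
  + rewrite !satI !satT => h1 h2 u v uv bu.
    have [v1 [uv1 cv1]] := h1 _ _ uv bu; have [v2 [uv2 dv2]] := h2 _ _ uv bu.
    (* Determinism merges the two witnesses, as A4 requires. *)
    rewrite -(det _ _ _ _ uv1 uv2) in dv2.
    exists v1; split=> //; rewrite !satI => h; exact: h cv1 dv2.
- by have := IHab w; rewrite satI; apply.
- rewrite satI !satT => h u v uv a1u; have := IHa u; rewrite satI => /(_ a1u) a2u.
  have [v' [uv' bv']] := h _ _ uv a2u; exists v'; split=> //.
  by have := IHb v'; rewrite satI; apply.
Qed.

(** * Maximal consistent sets *)

(** Rule M stays confined to theorems, which makes the deduction theorem hold. *)
Inductive entails (S : set formula) : formula -> Prop :=
| entails_Red a : Red a -> entails S a
| entails_in a : S a -> entails S a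
| entails_mp a b : entails S (a ~> b)%F -> entails S a -> entails S b.

Lemma entails_K S a b : entails S b -> entails S (a ~> b)%F.
Proof. by apply: entails_mp; apply/entails_Red/CPL_K. Qed.

Lemma entails_S S a b c : entails S (a ~> (b ~> c))%F -> entails S (a ~> b)%F ->
  entails S (a ~> c)%F.
Proof. by move=> h; apply: entails_mp; apply: entails_mp h; apply/entails_Red/CPL_S. Qed.

Lemma deduction S a b : entails (a |` S) b -> entails S (a ~> b)%F.
Proof.
elim=> {b} [b rb|b [->|Sb]|b c _ + _]; last exact: entails_S.
- exact/entails_K/entails_Red.
- by apply: (@entails_S _ _ (a ~> a)%F); apply/entails_Red/CPL_K.
- exact/entails_K/entails_in.
Qed.

Lemma entails_sub S S' a : S `<=` S' -> entails S a -> entails S' a.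
Proof.
move=> SS'; elim=> {a} [a|a /SS'|a b _ + _]; first exact: entails_Red.
- exact: entails_in.
- exact: entails_mp.
Qed.

Lemma entails_set0 a : entails set0 a -> Red a.
Proof. by elim=> {a} // a b _ + _; apply: MP. Qed.

(** A derivation uses finitely many hypotheses, so they lie in one member of the chain; the first
    alternative covers the empty chain. *)
Lemma entails_bigcup (F : set (set formula)) a : total_on F subset ->
  entails (\bigcup_(X in F) X) a -> entails set0 a \/ exists2 X, F X & entails X a.
Proof.
move=> Ft; elim=> {a} [a ra|a [X FX Xa]|a b _ IH1 _ IH2].
- by left; apply: entails_Red.
- by right; exists X => //; apply: entails_in.
- case: IH1 IH2 => [h1|[X FX h1]] [h2|[Y FY h2]].
  + by left; apply: entails_mp h2.
  + by right; exists Y => //; apply: entails_mp h2; apply: entails_sub h1.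
  + by right; exists X => //; apply: entails_mp h1 _; apply: entails_sub h2.
  + by have [XY|YX] := Ft _ _ FX FY; right; [exists Y|exists X] => //;
      [apply: entails_mp h2; apply: entails_sub h1
      |apply: entails_mp h1 _; apply: entails_sub h2].
Qed.

(** Under [Neg c] the first premise refutes [a]; this yields [a ~> b], hence [c]. *)
Lemma entails_cases S a b c : entails S (a ~> c)%F ->
  entails S ((a ~> b) ~> c)%F -> entails S c.
Proof.
move=> h1 h2; apply: entails_mp (entails_Red _ (CPL_DN _ c)) _.
apply: deduction; set S' := _ |` _.
have w x : entails S x -> entails S' x by apply: entails_sub => y; right.
have nc : entails S' (Neg c) by apply: entails_in; left.
apply: (entails_mp nc); apply: (entails_mp (w _ h2)); apply: deduction.
apply: entails_mp (entails_Red _ (CPL_DN _ b)) _; apply: entails_K.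
have w' x : entails S' x -> entails (a |` S') x by apply: entails_sub => y; right.
apply: (entails_mp (w' _ nc)); apply: (entails_mp (w' _ (w _ h1))).
by apply: entails_in; left.
Qed.

Definition maximal_consistent (T : set formula) : Prop :=
  [/\ forall a, Red a -> T a, ~ T Bot &
      forall a b, T (a ~> b)%F <-> (T a -> T b)].

(* A set maximal among those that do not entail [a] decides every formula. *)
Lemma Lindenbaum a : ~ Red a -> exists2 T, maximal_consistent T & ~ T a.
Proof.
move=> na; have [F Fsub Ft|T [nTa Tmax]] :=
    @Zorn_bigcup _ [set S | ~ entails S a] _.
  by case/(entails_bigcup Ft) => [/entails_set0|[X /Fsub]].
have Text b : ~ T b -> entails T (b ~> a)%F.
  move=> nTb; apply: deduction; apply: contrapT; apply: Tmax.
  by split=> [x|/(_ b (or_introl erefl))//]; right.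
have Tcl b : entails T b -> T b.
  by move=> h; apply: contrapT => /Text /entails_mp /(_ h).
exists T; last by move=> /(entails_in (a:=a)).
split=> [b rb||b c]; first exact/Tcl/entails_Red.
- move=> /(entails_in (a:=Bot)) TB; apply: nTa.
  by apply: entails_mp (entails_Red _ (CPL_DN _ a)) _; apply: entails_K.
- split=> [Tbc Tb|h].
    by apply: Tcl; apply: entails_mp (entails_in Tbc) (entails_in Tb).
  have [Tb|/Text nTb] := pselect (T b); first exact/Tcl/entails_K/entails_in/h.
  by apply: contrapT => /Text; move/(entails_cases nTb).
Qed.

Lemma Red_maximal_consistent a :
  (forall T, maximal_consistent T -> T a) -> Red a.
Proof. by move=> h; apply: contrapT => /Lindenbaum[T /h]. Qed.

Lemma maximal_consistent_Neg T a : maximal_consistent T ->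
  T (Neg a) <-> ~ T a.
Proof. by case=> _ TB ->; split=> h /h. Qed.

Lemma maximal_consistent_Or T a b : maximal_consistent T ->
  T (Or a b) <-> T a \/ T b.
Proof.
move=> mT; have [_ _ ->] := mT; rewrite (maximal_consistent_Neg a mT).
have := EM (T a); tauto.
Qed.

Lemma maximal_consistent_And T a b : maximal_consistent T ->
  T (And a b) <-> T a /\ T b.
Proof.
move=> mT; have [_ _ TI] := mT.
rewrite (maximal_consistent_Neg _ mT) TI (maximal_consistent_Neg b mT).
have := EM (T a); have := EM (T b); tauto.
Qed.

Lemma maximal_consistent_RuleM T a1 a2 b1 b2 : maximal_consistent T ->
  (forall T', maximal_consistent T' -> T' a1 -> T' a2) ->
  (forall T', maximal_consistent T' -> T' b1 -> T' b2) ->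
  T (a2 |> b1)%F -> T (a1 |> b2)%F.
Proof.
move=> [Tr _ TI] h1 h2; apply/TI/Tr/RuleM; apply: Red_maximal_consistent => T' mT';
  case: (mT') => _ _ ->; [exact: h1|exact: h2].
Qed.

(* If [T] contains [b' |> c'], then [b |> c] can only be refuted by sending a
   [b]-set without [b'] to a set without [c], or a [b]-set with [b'] to a set
   with [c'] and without [c]; A1 and A4 say that one of the two is possible. *)
Lemma refuting_pair T (s : seq (formula * formula)) b c : maximal_consistent T ->
  (forall b' c', (b', c') \in s -> T (b' |> c')%F) -> ~ T (b |> c)%F ->
  exists T1 T2, [/\ maximal_consistent T1, maximal_consistent T2, T1 b, ~ T2 c &
    forall b' c', (b', c') \in s -> T1 b' -> T2 c'].
Proof.
move=> mT; have [Tr TB TI] := mT.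
elim: s b c => [|[b' c'] s IHs] b c sT nTbc.
  have [T1 mT1 T1b] : exists2 T1, maximal_consistent T1 & T1 b.
    apply: contrapT => h; apply: nTbc.
    apply: (@maximal_consistent_RuleM T b Bot c c mT) => //.
      by move=> T' mT' T'b; case: h; exists T'.
    exact/Tr/Axm/Red_Re/A2.
  have [T2 mT2 T2c] : exists2 T2, maximal_consistent T2 & ~ T2 c.
    apply: contrapT => h; apply: nTbc.
    apply: (@maximal_consistent_RuleM T b b Top c mT) => //.
      by move=> T' mT' _; apply: contrapT => nc; case: h; exists T'.
    exact/Tr/Axm/Red_Re/A3.
  by exists T1, T2.
have sT' b0 c0 : (b0, c0) \in s -> T (b0 |> c0)%F.
  by move=> h; apply: sT; rewrite inE h orbT.
(* If this formula is not in [T], a pair refuting it omits [b'] from [T1] and meets the new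
   constraint vacuously. *)
have [h|/(IHs _ _ sT')] := pselect (T (And b (Neg b') |> c)%F); last first.
  case=> T1 [T2 [mT1 mT2]].
  rewrite (maximal_consistent_And _ _ mT1) (maximal_consistent_Neg _ mT1).
  case=> T1b T1b' T2c sT1.
  exists T1, T2; split=> // b0 c0; rewrite inE => /predU1P[[-> _]//|]; exact: sT1.
(* Otherwise this formula is refuted, by a pair with [c'] in [T2]: were it in [T], A4 would give
   [And b b' |> c], and A1 would join the two cases. *)
have : ~ T (And b b' |> (c' ~> c))%F.
  move=> h1; apply: nTbc.
  have h2 : T (And b b' |> c')%F.
    apply: (@maximal_consistent_RuleM T _ b' c' _ mT) => //.
      by move=> T' mT'; rewrite (maximal_consistent_And _ _ mT') => -[].
    by apply: sT; rewrite inE eqxx.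
  have h3 : T (And b b' |> c)%F.
    have : T (And b b' |> And c' (c' ~> c))%F.
      by have := Tr _ (Axm (A4 (And b b') c' (c' ~> c)%F)); rewrite !TI; apply.
    apply: maximal_consistent_RuleM => // T' mT'; have [_ _ T'I] := mT'.
    by rewrite (maximal_consistent_And _ _ mT') T'I => -[c'T]; apply.
  have : T (Or (And b b') (And b (Neg b')) |> c)%F.
    have := Tr _ (Axm (Red_Re (A1 (And b b') c (And b (Neg b'))))).
    by rewrite !TI; apply.
  apply: maximal_consistent_RuleM => // T' mT' T'b.
  rewrite (maximal_consistent_Or _ _ mT') !(maximal_consistent_And _ _ mT').
  by rewrite (maximal_consistent_Neg _ mT'); have [] := EM (T' b'); [left|right].
case/(IHs _ _ sT') => T1 [T2 [mT1 mT2]].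
have [_ _ ->] := mT2; rewrite (maximal_consistent_And _ _ mT1).
case=> T1b _ /not_implyP[T2c' T2c] sT1.
exists T1, T2; split=> // b0 c0; rewrite inE => /predU1P[[_ ->]//|]; exact: sT1.
Qed.

(** * Finite deterministic countermodels *)

Fixpoint subformulas (a : formula) : seq formula :=
  a :: match a with
       | Imp b c | Tri b c => subformulas b ++ subformulas c
       | _ => [::]
       end.

Lemma subformulas_refl a : a \in subformulas a.
Proof. by case: a => *; rewrite inE eqxx. Qed.

Lemma subformulas_trans a b c :
  a \in subformulas b -> b \in subformulas c -> a \in subformulas c.
Proof.
move=> ab; elim: c => [p|//|c IHc d IHd|c IHc d IHd] /=; rewrite ?in_cons ?in_nil.
- by rewrite orbF => /eqP bE; move: ab; rewrite bE.
- by rewrite orbF => /eqP bE; move: ab; rewrite bE.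
- by rewrite !mem_cat => /predU1P[bE|/orP[/IHc|/IHd] ->];
    rewrite ?orbT //; move: ab; rewrite bE /= inE mem_cat.
- by rewrite !mem_cat => /predU1P[bE|/orP[/IHc|/IHd] ->];
    rewrite ?orbT //; move: ab; rewrite bE /= inE mem_cat.
Qed.

Section canonical_model.
Variable phi : formula.
Let s := subformulas phi.
Let type := {ffun seq_sub s -> bool}.

Definition type_of (T : set formula) : type := [ffun a => `[< T (ssval a) >]].

Lemma type_of_eq T T' a : a \in s -> type_of T = type_of T' -> T a <-> T' a.
Proof.
by move=> sa /ffunP /(_ (SeqSub sa)); rewrite !ffunE /=; apply: asbool_eq_equiv.
Qed.

(* [uv] consists of the types of a pair given by [refuting_pair] for [t] and [i]. *)
Definition refutes (t : type) (i : seq_sub s) (uv : type * type) : Prop :=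
  exists T T1 T2, [/\ maximal_consistent T, maximal_consistent T1,
    maximal_consistent T2, t = type_of T & uv = (type_of T1, type_of T2)] /\
  exists b c, [/\ ssval i = (b |> c)%F, ~ T (b |> c)%F, T1 b, ~ T2 c &
    forall b' c', (b' |> c')%F \in s -> T (b' |> c')%F -> T1 b' -> T2 c'].

(* The second component only makes copies of each type: a step out of the copy
   [i] of a type serves to refute the formula [i], so that one type can be used
   against several formulas without breaking determinism. *)
Definition canonical_model : kripke := @Kripke (type * seq_sub s)%type
  (fun w u v => [/\ v.2 = u.2, refutes w.1 u.2 (u.1, v.1) &
     xget (w.1, w.1) (refutes w.1 u.2) = (u.1, v.1)])
  (fun w p => exists T, [/\ maximal_consistent T, w.1 = type_of T & T (Var p)]).

Lemma canonical_model_deterministic : deterministic canonical_model.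
Proof.
by move=> /= w [u i] [v j] [v' j'] /= [-> _ ->] [-> _ [->]].
Qed.

Lemma truth T i a : maximal_consistent T -> a \in s ->
  @forces canonical_model (type_of T, i) a <-> T a.
Proof.
elim: a T i => [p||b IHb c IHc|b IHb c IHc] T i mT sa.
- split=> [[T' [mT' /= e T'p]]|Tp]; last by exists T.
  by rewrite (type_of_eq sa e).
- by have [_ TB _] := mT; split.
- have sb : b \in s.
    by apply: subformulas_trans sa; rewrite inE mem_cat subformulas_refl orbT.
  have sc : c \in s.
    by apply: subformulas_trans sa; rewrite inE mem_cat subformulas_refl !orbT.
  have [_ fI _] := forces_satisfaction canonical_model.
  by have [_ _ TI] := mT; rewrite fI TI IHb // IHc.
- have sb : b \in s.
    by apply: subformulas_trans sa; rewrite inE mem_cat subformulas_refl orbT.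
  have sc : c \in s.
    by apply: subformulas_trans sa; rewrite inE mem_cat subformulas_refl !orbT.
  have [_ _ fT] := forces_satisfaction canonical_model; rewrite {}fT.
  split=> [fT|Tbc [u k] [v k'] /= uv fu].
  + apply: contrapT => nT.
    (* Subformulas of another shape contribute the harmless constraint [(Bot, Bot)]. *)
    pose l := [seq x <- [seq (if a is Tri b c then (b, c) else (Bot, Bot)) | a <- s]
              | `[< T (x.1 |> x.2)%F >]].
    have [|T1 [T2 [mT1 mT2 T1b T2c h]]] := @refuting_pair T l b c mT _ nT.
      by move=> b' c'; rewrite mem_filter => /andP[/asboolP].
    have : exists uv, refutes (type_of T) (SeqSub sa) uv.
      exists (type_of T1, type_of T2), T, T1, T2; split=> //.
      exists b, c; split=> // b' c' s' T'; apply: h.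
      rewrite mem_filter; apply/andP; split; first exact/asboolP.
      by apply/mapP; exists (b' |> c')%F.
    move=> /(xgetPex (type_of T, type_of T)).
    case e : (xget _ _) => [u v] r.
    have st : @step canonical_model (type_of T, i) (u, SeqSub sa) (v, SeqSub sa) by [].
    (* The pair chosen by [xget] may differ from that of [T1] and [T2]; it suffices that it refutes
       the same formula. *)
    have [T' [T1' [T2' [[mT' mT1' mT2' _ [eu ev]] [b0 [c0 [[eb ec] _ T1b' T2c' _]]]]]]] := r.
    rewrite -{}eb -{}ec in T1b' T2c'.
    have [|v' [st' fv']] := fT _ _ st; first by rewrite eu IHb.
    rewrite -(canonical_model_deterministic st st') ev IHc // in fv'.
  (* Whatever formula the step refutes, its pair respects every triangle formula of [s] in a set of
     the same type as [T]. *)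
  + exists (v, k'); split=> //; have [/= _ r _] := uv.
    have [T' [T1' [T2' [[mT' mT1' mT2' e [eu ev]] [_ [_ [_ _ _ _ h]]]]]]] := r.
    rewrite ev IHc //; apply: (h b) => //; first by rewrite -(type_of_eq sa e).
    by move: fu; rewrite eu => /(IHb _ _ mT1' sb).
Qed.

End canonical_model.

Lemma kripke_completeness phi :
  (forall M : kripke, deterministic M -> forall w : M, forces w phi) -> Red phi.
Proof.
move=> h; apply: Red_maximal_consistent => T mT.
have sphi := subformulas_refl phi.
apply/(truth (SeqSub sphi) mT sphi)/h/canonical_model_deterministic.
Qed.

(** * Finite modifications of recursive functions *)

Lemma sem_comp m n (f : murec m) (gs : 'I_m -> murec n) xs (ys : m.-tuple nat) :
  (forall i, sem (gs i) xs = [set tnth ys i]) -> sem (MComp f gs) xs = sem f ys.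
Proof.
move=> h; apply/seteqP; split=> [y /= [zs [hz]]|y fy /=].
  by congr (sem f _ y); apply: eq_from_tnth => i; have := hz i; rewrite h.
by exists ys; split=> // i; rewrite h.
Qed.

(* [MMin (MProj ord0)] is a filler: the arguments of [MZero] are indexed by 'I_0. *)
Fixpoint const_murec n (b : nat) : murec n :=
  if b is b'.+1 then MComp MSucc (fun _ => const_murec n b')
  else MComp MZero (fun _ => MMin (MProj ord0)).

Lemma sem_const n b (xs : n.-tuple nat) : sem (const_murec n b) xs = [set b].
Proof.
elim: b => [|b IHb]; first by rewrite /const_murec (@sem_comp _ _ _ _ _ [tuple]) // => -[].
by rewrite [LHS](@sem_comp _ _ _ _ _ [tuple b]) // => i; rewrite IHb (ord1 i).
Qed.

Fixpoint neq_murec (a : nat) : murec 1 :=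
  if a is a'.+1
  then MRec (const_murec 0 1) (MComp (neq_murec a') (fun _ => MProj ord0))
  else MRec (const_murec 0 0) (const_murec 2 1).

Lemma sem_rec n (f : murec n) (g : murec n.+2) x (xs : n.-tuple nat) :
  sem (MRec f g) [tuple of x :: xs] =
  iter_rec (sem f xs) (fun k z => sem g [tuple of k :: z :: xs]) x.
Proof.
rewrite /= theadE; congr (iter_rec _ _ x).
  by congr (sem f _); apply: val_inj.
by apply/funext => k; apply/funext => z; congr (sem g _); apply: val_inj.
Qed.

(** The step ignores the previous value, but that value must converge, whence the induction. *)
Lemma sem_rec_case n (f : murec n) (g : murec n.+2) (xs : n.-tuple nat) b h :
  sem f xs = [set b] ->
  (forall k z, sem g [tuple of k :: z :: xs] = [set h k]) ->
  forall x, sem (MRec f g) [tuple of x :: xs] = [set if x is k.+1 then h k else b].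
Proof.
move=> fE gE x; rewrite sem_rec fE; set G := (fun k z => _).
by elim: x => [//|x IHx] /=; rewrite IHx bigcup_set1 /G gE.
Qed.

Lemma sem_neq a x : sem (neq_murec a) [tuple x] = [set nat_of_bool (x != a)].
Proof.
elim: a x => [|a IHa] x.
  by rewrite (sem_rec_case (sem_const _ _) (fun _ _ => sem_const _ _)); case: x.
rewrite (@sem_rec_case _ _ _ _ _ (fun k => nat_of_bool (k != a)) (sem_const _ _)) => [|k z].
  by case: x.
rewrite (@sem_comp _ _ _ _ _ [tuple k]) ?IHa // => i.
by rewrite (ord1 i) /= (tnth_nth 0).
Qed.

(* Composition is strict, so the case distinction is made by primitive recursion,
   which leaves [p] unevaluated when the test is 0. *)
Definition patch_murec (p : murec 1) (a b : nat) : murec 1 :=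
  MComp (MRec (const_murec 1 b) (MComp p (fun _ => MProj (inord 2 : 'I_3))))
        (fun i : 'I_2 => if i == ord0 then neq_murec a else MProj ord0).

Lemma sem_patch p a b x : sem (patch_murec p a b) [tuple x] =
  if x == a then [set b] else sem p [tuple x].
Proof.
rewrite /patch_murec (@sem_comp _ _ _ _ _ [tuple nat_of_bool (x != a); x]); last first.
  move=> i; have [->|] := eqVneq i ord0; first by rewrite sem_neq.
  by case: i => [[|[|?]] //= ? _]; rewrite !(tnth_nth 0).
(* The step receives the counter, the previous value and [x]; index 2 selects [x]. *)
set r := MComp p _; have rE ys : sem r ys = sem p [tuple tnth ys (inord 2)].
  by apply: sem_comp => i; rewrite (ord1 i).
rewrite sem_rec sem_const; set G := (fun k z => _).
case: (x == a); rewrite //= bigcup_set1 /G rE; congr (sem p _).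
by apply: eq_from_tnth => i; rewrite (ord1 i) !(tnth_nth 0) /= inordK.
Qed.

Lemma sem_diverges n (p : murec n.+1) (xs : n.-tuple nat) :
  (forall y, ~ sem p [tuple of y :: xs] 0) -> sem (MMin p) xs = set0.
Proof. by move=> h; apply/seteqP; split=> // y [/h]. Qed.

Fixpoint depth (a : formula) : nat :=
  match a with
  | Var _ | Bot => 0
  | Imp b c => maxn (depth b) (depth c)
  | Tri b c => (maxn (depth b) (depth c)).+1
  end.

(** * Recursive functions over the universe [U] *)

Section numbering.
Variables (U : Type) (code : U -> nat).
Hypothesis code_bij : bijective code.
Let code_inj : injective code := bij_inj code_bij.

Lemma partial_recursive1P (F : U -> set U) :
  partial_recursive1 code F <->
  exists p : murec 1, forall x, F x = [set y | sem p [tuple code x] (code y)].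
Proof.
have tE (xs : 1.-tuple U) : map_tuple code xs = [tuple code (thead xs)].
  by apply: eq_from_tnth => i; rewrite (ord1 i) tnth_map.
split=> -[p h]; exists p => x; last by rewrite tE.
by have := h [tuple x]; rewrite theadE tE.
Qed.

Lemma partial_recursive1_const c : partial_recursive1 code (fun=> [set c]).
Proof.
apply/partial_recursive1P; exists (const_murec 1 (code c)) => x.
by rewrite sem_const; apply/seteqP; split=> y /= => [->|/code_inj].
Qed.

Lemma partial_recursive1_set0 : partial_recursive1 code (fun=> set0).
Proof.
apply/partial_recursive1P; exists (MMin (const_murec 2 1)) => x.
by rewrite (@sem_diverges 1) // => y; rewrite sem_const.
Qed.

Lemma partial_recursive1_patch F a b : partial_recursive1 code F ->
  partial_recursive1 code (fun x => if code x == a then [set b] else F x).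
Proof.
move=> /partial_recursive1P[p pE]; apply/partial_recursive1P.
exists (patch_murec p a (code b)) => x; rewrite sem_patch; case: ifP => _ //.
by apply/seteqP; split=> y /= => [->|/code_inj].
Qed.

Lemma partial_recursive1_subset1 F x : partial_recursive1 code F ->
  is_subset1 (F x).
Proof.
by move=> /partial_recursive1P[p ->] y y' /= h h'; apply/code_inj/(sem_subset1 h h').
Qed.

(** Arguments are patched one at a time, from the largest code below [N] downwards. *)
Lemma partial_recursive1_finite_modification F G N : partial_recursive1 code F ->
  (forall x, N <= code x -> G x = F x) ->
  (forall x, G x = F x \/ exists b, G x = [set b]) -> partial_recursive1 code G.
Proof.
have [decode _ decodeK] := code_bij.
elim: N F => [|N IHN] F Frec GF Gval.
  by have -> : G = F by apply/funext => x; apply: GF.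
pose F' x := if code x == N then G x else F x.
have codeN x : code x = N -> x = decode N by move=> <-; apply: code_inj; rewrite decodeK.
apply: (IHN F') => [|x|x].
- have [GFN|[b Gb]] := Gval (decode N).
    have -> // : F' = F.
    by apply/funext => x; rewrite /F'; case: eqP => // /codeN ->.
  have -> : F' = fun x => if code x == N then [set b] else F x.
    by apply/funext => x; rewrite /F'; case: eqP => // /codeN ->.
  exact: partial_recursive1_patch.
- by rewrite /F' leq_eqVlt eq_sym; case: eqP => //= _; apply: GF.
- by rewrite /F'; case: eqP => _; [left|apply: Gval].
Qed.

(** * Fresh indices and the embedding of Kripke models *)

Variable xi : U -> U -> set U.
Hypothesis xi_enum : enumeration code xi.

Lemma index_exists F : partial_recursive1 code F -> exists u, xi u = F.
Proof. by move=> /(proj2 xi_enum)[u uF]; exists u; apply/funext. Qed.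

Hypothesis xi_rec : recursion_theorem code xi.

(* A fixed point of the map sending the indices of [F] below [N] to an index of
   another function, and everything else to an index of [F], is an index of [F]
   that is not below [N]. *)
Lemma padding F N : partial_recursive1 code F ->
  exists2 u, N <= code u & xi u = F.
Proof.
move=> Frec; have [e eF] := index_exists Frec.
(* A constant function if [F] is empty, the empty function otherwise. *)
have [c cF] : exists c, xi c <> F.
  have [F0|nF0] := pselect (F = fun=> set0).
    have [c cE] := index_exists (partial_recursive1_const e).
    by exists c; rewrite cE F0 => /funeqP /(_ e) /seteqP[/(_ e erefl)].
  by have [c cE] := index_exists partial_recursive1_set0; exists c; rewrite cE => /esym.
pose f u := if `[< code u < N /\ xi u = F >] then c else e.
have [|u uf] := @xi_rec 1 (fun _ xs => f (thead xs)).
  move=> _; rewrite -[total_recursive _ _]/(partial_recursive1 code (fun x => [set f x])).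
  apply: (@partial_recursive1_finite_modification (fun=> [set e]) _ N).
  - exact: partial_recursive1_const.
  - by move=> x Nx; rewrite /f; case: asboolP => // -[]; rewrite ltnNge Nx.
  - by move=> x; right; exists (f x).
have {uf} : xi (thead u) = xi (f (thead u)) by apply/funext/uf.
rewrite /f; case: asboolP => [[_ ->] /esym //|nf uF].
exists (thead u); last by rewrite uF.
by rewrite leqNgt; apply/negP => uN; apply: nf; rewrite uF.
Qed.

(** Each world in turn receives an index padded beyond those already used. *)
Lemma fresh_indices (W : finType) (T : W -> U -> set U) N :
  (forall w, partial_recursive1 code (T w)) ->
  exists (g : W -> U) (M : nat), [/\ injective g, N <= M,
    forall w, xi (g w) = T w & forall w, N <= code (g w) < M].
Proof.
move=> Trec.
suff /(_ (enum W))[g [M [ginj NM gT gM]]] : forall s : seq W, exists (g : W -> U) (M : nat),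
    [/\ {in s &, injective g}, N <= M, {in s, forall w, xi (g w) = T w} &
        {in s, forall w, N <= code (g w) < M}].
  exists g, M; split=> // [w w'|w|w].
  - by apply: ginj; rewrite mem_enum.
  - by apply: gT; rewrite mem_enum.
  - by apply: gM; rewrite mem_enum.
elim=> [|w0 s [g [M [ginj NM gT gM]]]].
  by have [u _ _] := padding N partial_recursive1_set0; exists (fun=> u), N.
have [u Mu uT] := padding M (Trec w0).
have ne w : w \in s -> g w <> u.
  by move=> /gM /andP[_ +] gwu; rewrite gwu ltnNge Mu.
have w0P w : w \in w0 :: s -> w \notin s -> w = w0.
  by rewrite inE => /predU1P[//|->].
exists (fun w => if w \in s then g w else u), (code u).+1; split.
+ move=> w w' ws ws'; case: ifPn => sw; case: ifPn => sw'.
  * exact: ginj.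
  * by move=> /(ne _ sw).
  * by move=> /esym /(ne _ sw').
  * by rewrite (w0P _ ws sw) (w0P _ ws' sw').
+ exact: leq_trans NM (leqW Mu).
+ by move=> w ws; case: ifPn => sw; [apply: gT|rewrite (w0P _ ws sw)].
+ move=> w ws; case: ifPn => sw; last by rewrite (leq_trans NM Mu) /=.
  by have /andP[-> gwM] := gM _ sw; rewrite ltnS (leq_trans (ltnW gwM) Mu).
Qed.

(* The world [w] is represented by a program whose graph consists of the pairs
   of programs that represent, one level of nesting below, the pairs (u, v) with
   u ->_w v.  The quantification over [V'] lets the valuation be extended to the
   fresh programs of the next level. *)
Lemma kripke_embedding (M : kripke) (d : nat) : deterministic M ->
  exists (V : nat -> set U) (g : M -> U) (N : nat),
    [/\ injective g, forall w, code (g w) < N &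
     forall V' : nat -> set U,
       (forall p x, code x < N -> V' p x <-> V p x) ->
     forall a, depth a < d -> forall w, interp xi V' a (g w) <-> forces w a].
Proof.
move=> det; elim: d => [|d [V [g [N [ginj gN gV]]]]].
  have [g [N [ginj _ _ gN]]] :=
    fresh_indices 0 (fun _ : M => partial_recursive1_set0).
  by exists (fun=> set0), g, N; split=> // w; have /andP[] := gN w.
pose T (w : M) x := [set y | exists u v, [/\ step w u v, x = g u & y = g v]].
have Trec w : partial_recursive1 code (T w).
  apply: (partial_recursive1_finite_modification (N := N) partial_recursive1_set0) => x.
    move=> Nx; apply/seteqP; split=> // y [u [v [_ xE _]]].
    by move: Nx; rewrite xE leqNgt gN.
  have [[y [u [v [uv xE _]]]]|Tx0] := pselect (T w x !=set0).
    right; exists (g v); apply/seteqP; split=> [z [u' [v' [uv' xE' ->]]]|_ ->].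
      have uu' : u = u' by apply: ginj; rewrite -xE.
      by rewrite -uu' in uv'; rewrite (det _ _ _ _ uv uv').
    by exists u, v.
  by left; apply/seteqP; split=> // y Ty; apply: Tx0; exists y.
have [g' [N' [g'inj NN' g'T g'N]]] := fresh_indices N Trec.
pose V' p : set U := [set x | (code x < N /\ V p x) \/ exists2 w, x = g' w & Defs.val w p].
exists V', g', N'; split=> // [w|W VW]; first by have /andP[] := g'N w.
(* The new valuation agrees with [V] below [N], so the previous level keeps its truth values. *)
have low a : depth a < d -> forall w, interp xi W a (g w) <-> forces w a.
  apply: gV => p x xN; rewrite VW ?(leq_trans xN) //.
  split=> [[[]//|[w xw]]|Vx]; last by left.
  by have /andP[] := g'N w; rewrite -xw leqNgt xN.
have [_ iI iT] := interp_satisfaction xi W; have [_ fI _] := forces_satisfaction M.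
elim=> [p||b IHb c IHc|b _ c _] ad w.
- rewrite [interp _ _ _ _]/= VW; last by have /andP[] := g'N w.
  split=> [[[]|[w' /g'inj ->]//]|]; last by right; exists w.
  by have /andP[+ _] := g'N w; rewrite ltnNge => ->.
- by [].
- by have := ad; rewrite [depth _]/= gtn_max => /andP[bd cd]; rewrite iI fI IHb // IHc.
(* The program [g' w] converges only on programs of the previous level, where [low] applies. *)
- have := ad; rewrite [depth _]/= ltnS gtn_max => /andP[bd cd]; rewrite iT g'T; split=> h.
  + move=> u v uv ub; have [||v' [[u1 [v1 [uv1 /ginj uu1 ->]]] cv1]] := h (g u) (g v).
    * by exists u, v.
    * exact/low.
    * by exists v1; rewrite uu1; split=> //; apply/low.
  + move=> x y [u [v [uv -> _]]] /(low _ bd) /(h _ _ uv)[v' [uv' cv']].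
    by exists (g v'); split; [exists u, v'|apply/low].
Qed.

End numbering.

Theorem theorem6 (phi : formula) (U : Type) (code : U -> nat)
    (code_bij : bijective code) (xi : U -> U -> set U)
    (xi_enum : enumeration code xi) (xi_rec : recursion_theorem code xi) :
  (valid xi phi <->
     (forall M : kripke, deterministic M -> forall w : M, forces w phi)) /\
  ((forall M : kripke, deterministic M -> forall w : M, forces w phi) <->
     Red phi).
Proof.
have Red_valid : Red phi -> valid xi phi.
  move=> rphi V; apply/seteqP; split=> // w _.
  apply: soundness (interp_satisfaction xi V) _ rphi w => w u v v'.
  exact: (partial_recursive1_subset1 code_bij (proj1 xi_enum w)).
split; split.
- move=> phi_valid M det w.
  have [V [g [N [_ _ gV]]]] :=
    kripke_embedding code_bij xi_enum xi_rec (depth phi).+1 det.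
  by apply/(gV V) => //; rewrite phi_valid.
- by move=> /kripke_completeness.
- exact: kripke_completeness.
- by move=> rphi M det; apply: soundness (forces_satisfaction M) det rphi.
Qed.
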